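(* Let $d\in\{2,3\}$. The expected values of $\mathrm{Chord}(k)$ on the equilateral arm and polygon spaces are $$E(\mathrm{Chord}(k),\mathrm{eArm}_d(n))=\frac{4k}{n^2},\qquad E(\mathrm{Chord}(k),\mathrm{ePol}_d(n))=\left(\frac{n-k}{n-1}\right)\frac{4k}{n^2}.$$
   Context: $\mathrm{eArm}_d(n)$ is the space of lists $(e_1,\dots,e_n)$ of vectors in $\mathbb{R}^d$ with $|e_i|=2/n$ for all $i$ (equilateral $n$-edge arms of total length $2$), i.e. the product of $n$ round spheres of dimension $d-1$ and radius $2/n$, with the product of the uniform probability measures. $\mathrm{ePol}_d(n)\subset\mathrm{eArm}_d(n)$ is the subspace of closed polygons, $\sum e_i=0$, with its subspace measure: the Riemannian volume measure of (the smooth part of) this subset as a submanifold of the product of round spheres, normalized to total mass $1$. $E(f,X)$ is the expectation of $f$ on $X$ with respect to these measures. $\mathrm{Chord}(k)=\left|\sum_{j=1}^k e_j\right|^2$ is the squared length of the chord skipping the first $k$ of the $n$ edges. *)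

(* Defs.v *)
From HB Require Import structures.
From mathcomp Require Import all_boot all_order all_algebra.
From mathcomp Require Import all_classical all_reals all_analysis.

Set Implicit Arguments.
Unset Strict Implicit.
Unset Printing Implicit Defensive.

Import Order.TTheory GRing.Theory Num.Theory.
Import numFieldNormedType.Exports.

Local Open Scope classical_set_scope.
Local Open Scope ring_scope.

(* The library norm on matrices is the sup norm; it only serves here to give
   the topology and the derivatives.  All lengths and angles are Euclidean. *)
Definition dotM (R : realType) (p q : nat) (A B : 'M[R]_(p, q)) : R :=
  \sum_(i < p) \sum_(j < q) A i j * B i j.

Definition enorm (R : realType) (p q : nat) (A : 'M[R]_(p, q)) : R :=
  Num.sqrt (dotM A A).

Definition borelM (R : realType) (p q : nat) :=
  g_sigma_algebraType (@open 'M[R]_(p, q)).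

(* An n-edge arm in R^d is the n x d matrix whose rows are its edges. *)
Definition sphere (R : realType) (d : nat) (r : R) : set 'rV[R]_d :=
  [set v | enorm v = r].

Definition eArm (R : realType) (d n : nat) : set 'M[R]_(n, d) :=
  [set e | forall i, sphere (2 / n%:R) (row i e)].

Definition ePol (R : realType) (d n : nat) : set 'M[R]_(n, d) :=
  @eArm R d n `&` [set e | \sum_(i < n) row i e = 0].

Definition Chord (R : realType) (d n k : nat) (e : 'M[R]_(n, d)) : R :=
  enorm (\sum_(j < n | (j < k)%N) row j e) ^+ 2.

Fixpoint Ck (R : realType) (m p q k : nat) (U : set 'rV[R]_m)
    (f : 'rV[R]_m -> 'M[R]_(p, q)) : Prop :=
  if k is k'.+1 then
    (forall u, U u -> differentiable f u) /\
    (forall v, Ck k' U (fun u => 'D_v f u))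
  else forall u, U u -> {for u, continuous f}.

Definition smooth (R : realType) (m p q : nat) (U : set 'rV[R]_m)
    (f : 'rV[R]_m -> 'M[R]_(p, q)) : Prop :=
  forall k, Ck k U f.

(* Matrix of the metric induced by the ambient Euclidean one.  On a product of
   round spheres the product metric is itself induced from the ambient space,
   so this is also the metric induced from that product. *)
Definition gram (R : realType) (m p q : nat)
    (f : 'rV[R]_m -> 'M[R]_(p, q)) (u : 'rV[R]_m) : 'M[R]_m :=
  \matrix_(i, j) dotM ('D_(delta_mx 0 i) f u) ('D_(delta_mx 0 j) f u).

(* The last clause says that f is open from U onto M, so that its inverse is
   continuous and its image (V := U) is relatively open in M. *)
Definition local_param (R : realType) (m p q : nat) (M : set 'M[R]_(p, q))
    (U : set 'rV[R]_m) (f : 'rV[R]_m -> 'M[R]_(p, q)) : Prop :=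
  [/\ open U,
      smooth U f,
      {in U &, injective f},
      (forall u, U u -> \det (gram f u) != 0) &
      (forall V, open V -> V `<=` U ->
         exists2 W, open W & f @` V = M `&` W)].

(* Points near which M is a smooth embedded submanifold.  The dimension is not
   prescribed: for n = 2 the polygon space is a sphere, whose dimension d - 1
   differs from the dimension n (d - 1) - d found for n > 2. *)
Definition smooth_part (R : realType) (p q : nat) (M : set 'M[R]_(p, q)) :
    set 'M[R]_(p, q) :=
  [set x | exists m (U : set 'rV[R]_m) (f : 'rV[R]_m -> 'M[R]_(p, q)),
             local_param M U f /\ (f @` U) x].

(* Lebesgue integral over R^m as an iterated one-dimensional integral; it is
   only applied to nonnegative Borel functions, where Tonelli's theorem
   identifies the two. *)
Fixpoint lebesgue_integral_rV (R : realType) (m : nat) :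
    ('rV[R]_m -> \bar R) -> \bar R :=
  if m is m'.+1 then
    fun g => (\int[@lebesgue_measure R]_x
      lebesgue_integral_rV (fun v : 'rV[R]_m' => g (row_mx (x%:M : 'rV[R]_1) v)))%E
  else fun g => g 0.

Definition param_volume (R : realType) (m p q : nat) (U : set 'rV[R]_m)
    (f : 'rV[R]_m -> 'M[R]_(p, q)) (B : set 'M[R]_(p, q)) : \bar R :=
  lebesgue_integral_rV (fun u =>
    (\1_(U `&` f @^-1` B) u * Num.sqrt (\det (gram f u)))%:E).

Definition riemannian_volume (R : realType) (p q : nat) (M : set 'M[R]_(p, q))
    (mu : {measure set (borelM R p q) -> \bar R}) : Prop :=
  mu.-negligible (~` smooth_part M) /\
  forall m (U : set 'rV[R]_m) (f : 'rV[R]_m -> 'M[R]_(p, q)),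
    local_param M U f ->
    forall B : set (borelM R p q), measurable B -> B `<=` f @` U ->
      mu B = param_volume U f B.

Definition normalized_volume (R : realType) (p q : nat) (M : set 'M[R]_(p, q))
    (P : probability (borelM R p q) R) : Prop :=
  exists mu : {measure set (borelM R p q) -> \bar R},
    [/\ riemannian_volume M mu,
        (0 < mu setT < +oo)%E &
        forall A : set (borelM R p q), measurable A ->
          P A = ((fine (mu setT))^-1%:E * mu A)%E].

Definition product_of_rows (R : realType) (d n : nat)
    (sigma : probability (borelM R 1 d) R)
    (P : probability (borelM R n d) R) : Prop :=
  forall A : 'I_n -> set (borelM R 1 d), (forall i, measurable (A i)) ->
    P [set e : 'M[R]_(n, d) | forall i, A i (row i e)]
      = (\prod_(i < n) sigma (A i))%E.

Definition eArm_measure (R : realType) (d n : nat)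
    (P : probability (borelM R n d) R) : Prop :=
  exists2 sigma : probability (borelM R 1 d) R,
    normalized_volume (@sphere R d (2 / n%:R)) sigma &
    product_of_rows sigma P.

Definition ePol_measure (R : realType) (d n : nat)
    (P : probability (borelM R n d) R) : Prop :=
  normalized_volume (@ePol R d n) P.

(* Main.v *)
(** Both expectations follow from E<e_i, e_j>, because Chord(k) is the sum of
    <e_i, e_j> over i, j < k and |e_i|^2 = 4/n^2.  For the arm, e_i and e_j are
    independent and the measure of the sphere is invariant under v |-> -v, so
    E<e_i, e_j> = 0 when i <> j.  For the polygon, the volume measure is
    invariant under permutation of the edges, so E<e_i, e_j> = c does not depend
    on i <> j, and Chord(n) = 0 gives c = - (4/n^2) / (n - 1).

    Both invariances are instances of one fact: a linear isometry T preserving M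
    maps each parametrization f of M to the parametrization T o f, which has the
    same Gram matrix; countably many parametrizations cover the smooth part of
    M, so T preserves the Riemannian volume. *)

Require Import Defs.
From HB Require Import structures.
From mathcomp Require Import all_boot all_order all_algebra.
From mathcomp Require Import all_classical all_reals all_analysis.
From mathcomp Require Import perm measurable_realfun ring lra.
Import Order.TTheory GRing.Theory Num.Theory.
Import numFieldNormedType.Exports.
Local Open Scope classical_set_scope.
Local Open Scope ring_scope.

Set Implicit Arguments.
Unset Strict Implicit.

(** * Locality of derivatives, and composition with a continuous linear map *)

Lemma near_eq_continuous_at {T U : topologicalType} (f g : T -> U) (x : T) :
  {near x, f =1 g} -> {for x, continuous f} -> {for x, continuous g}.
Proof.
move=> fg; rewrite /prop_for /continuous_at -(nbhs_singleton fg).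
by apply: cvg_trans; exact: near_eq_cvg.
Qed.

(** The difference [g - f] vanishes near [x], so the zero map satisfies the expansion that
    characterizes its differential; then [g] is [f] plus a differentiable map. *)
Lemma near_eq_differentiable {R : numFieldType} {V W : normedModType R}
    (f g : V -> W) (x : V) :
  {near x, f =1 g} -> differentiable f x -> differentiable g x.
Proof.
move=> fg df.
suff dh : differentiable (g - f) x.
  by rewrite -(subrK f g); exact: differentiableD.
have hx : (g - f) x = 0.
  by rewrite -[LHS]/(g x - f x) (nbhs_singleton fg) subrr.
have fg0 : \forall h \near (0 : V), f (h + x) = g (h + x).
  by rewrite (near_shift x 0); apply: filterS fg => u; rewrite /= sub0r addrNK.
have h0 : (g - f) \o shift x = cst ((g - f) x) + \0 +o_ 0 id.
  apply/eqaddoP => e e0; rewrite hx; near=> h.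
  rewrite /= !fctE /= !addr0 subr0.
  suff -> : g (h + x) = f (h + x) by rewrite subrr normr0 mulr_ge0// ltW.
  by apply/esym; near: h.
have c0 : continuous (\0 : V -> W) by move=> y; exact: cvg_cst.
apply/diff_locallyP.
have -> : 'd (g - f) x = \0 :> (V -> W) by exact: diff_unique.
by split.
Unshelve. all: by end_near. Qed.

(* The iterated directional derivatives of [T \o f] and of [f] may be unrelated
   outside U (junk values of limits), hence this locality statement. *)
Lemma eq_Ck (R : realType) (m p q k : nat) (U : set 'rV[R]_m)
    (f g : 'rV[R]_m -> 'M[R]_(p, q)) :
  open U -> (forall u, U u -> f u = g u) -> Ck k U f -> Ck k U g.
Proof.
move=> oU; elim: k f g => [|k IH] f g fg.
all: have nfg u : U u -> \forall u' \near u, f u' = g u' by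
  move=> Uu; apply: filterS (open_nbhs_nbhs (conj oU Uu)); exact: fg.
  by move=> cf u Uu; exact: near_eq_continuous_at (nfg u Uu) (cf u Uu).
move=> [df Cf]; split=> [u Uu|v].
  exact: near_eq_differentiable (nfg u Uu) (df u Uu).
by apply: IH (Cf v) => u Uu; exact: near_eq_derive (nfg u Uu).
Qed.

Lemma derive_linear_comp {R : numFieldType} {V W X : normedModType R}
    (T : {linear W -> X}) (f : V -> W) (u v : V) :
  continuous T -> differentiable f u -> 'D_v (T \o f) u = T ('D_v f u).
Proof.
move=> cT df.
have dT : differentiable T (f u) by exact: linear_differentiable.
rewrite !deriveE//; last exact: differentiable_comp.
by rewrite diff_comp//= diff_lin.
Qed.

Lemma Ck_linear_comp (R : realType) (m p q p' q' k : nat) (U : set 'rV[R]_m)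
    (f : 'rV[R]_m -> 'M[R]_(p, q)) (T : {linear 'M[R]_(p, q) -> 'M[R]_(p', q')}) :
  open U -> continuous T -> Ck k U f -> Ck k U (T \o f).
Proof.
move=> oU cT; elim: k f => [|k IH] f.
  by move=> cf u Uu; apply: continuous_comp; [exact: cf|exact: cT].
move=> [df Cf]; split=> [u Uu|v].
  apply: differentiable_comp; first exact: df.
  exact: linear_differentiable.
(* The derivative of [T \o f] is known to be [T \o 'D_v f] only on [U], where [f] is differentiable,
   so the induction hypothesis has to be transported by locality. *)
apply: eq_Ck (IH _ (Cf v)) => // u Uu.
by rewrite derive_linear_comp//; exact: df.
Qed.

(** * Transport of parametrizations by a linear isometry preserving [M] *)

Section linear_isometry.
Variables (R : realType) (p q : nat) (M : set 'M[R]_(p, q)).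
Variables T S : {linear 'M[R]_(p, q) -> 'M[R]_(p, q)}.
Hypotheses (cT : continuous T) (cS : continuous S).
Hypotheses (TK : cancel T S) (SK : cancel S T).
Hypothesis dotT : forall A B, dotM (T A) (T B) = dotM A B.
Hypothesis MT : forall A, M (T A) <-> M A.

Lemma gram_isometry_comp m (f : 'rV[R]_m -> 'M[R]_(p, q)) u :
  differentiable f u -> gram (T \o f) u = gram f u.
Proof.
by move=> df; apply/matrixP => i j; rewrite !mxE !derive_linear_comp// dotT.
Qed.

Lemma local_param_isometry_comp m (U : set 'rV[R]_m) f :
  local_param M U f -> local_param M U (T \o f).
Proof.
move=> [oU sf injf detf openf].
have df u : U u -> differentiable f u by case: (sf 1%N) => + _; exact.
split => //.
- by move=> k; exact: Ck_linear_comp.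
- by move=> x y Ux Uy /(can_inj TK); exact: injf.
- by move=> u Uu; rewrite gram_isometry_comp//; [exact: detf|exact: df].
- move=> V oV VU; have [W oW fV] := openf V oV VU.
  exists (S @^-1` W); first by apply: open_comp => // x _; exact: cS.
  rewrite -image_comp fV; apply/seteqP; split.
    by move=> _ [x [Mx Wx] <-]; split; [exact/MT|rewrite /= TK].
  move=> x [Mx Wx]; exists (S x) => //.
  by split => //; apply/MT; rewrite SK.
Qed.

Lemma smooth_part_isometry x : smooth_part M x -> smooth_part M (T x).
Proof.
move=> [m [U [f [lpf [u Uu <-]]]]]; exists m, U, (T \o f).
by split; [exact: local_param_isometry_comp|exists u].
Qed.

End linear_isometry.

(** Countable additivity when the pieces cover the space only up to a null set, as charts do for a
    Riemannian volume. *)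
Lemma measure_sum_partition d (T : measurableType d) (R : realType)
    (mu : {measure set T -> \bar R}) (D : nat -> set T) (B : set T) :
  (forall n, measurable (D n)) -> trivIset setT D -> mu (~` \bigcup_n D n) = 0%E ->
  measurable B -> mu B = (\sum_(n <oo) mu (B `&` D n))%E.
Proof.
move=> mD tD D0 mB.
have mU : measurable (\bigcup_n D n) by exact: bigcupT_measurable.
have BU0 : mu (B `\` \bigcup_n D n) = 0%E.
  apply: subset_measure0 D0; [exact: measurableD|exact: measurableC|].
  exact: subIsetr.
transitivity (mu (B `\` \bigcup_n D n) + mu (B `&` \bigcup_n D n))%E.
  exact: measureDI.
rewrite BU0 add0e.
rewrite setI_bigcupr measure_semi_bigcup//.
- by move=> n; exact: measurableI.
- exact: trivIset_setIl.
- by rewrite -setI_bigcupr; exact: measurableI.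
Qed.

(** * Borel sets of matrices and countable covers by charts *)

Section borel_matrix.
Variable R : realType.

Lemma open_measurableM p q (A : set 'M[R]_(p, q)) :
  open A -> measurable (A : set (borelM R p q)).
Proof. exact: sub_sigma_algebra. Qed.

Lemma continuous_measurable_funM p q p' q' (f : 'M[R]_(p, q) -> 'M[R]_(p', q')) :
  continuous f ->
  measurable_fun (setT : set (borelM R p q)) (f : borelM R p q -> borelM R p' q').
Proof.
move=> /continuousP cf.
apply: (@measurability _ _ (borelM R p q) (borelM R p' q') setT f open) => //.
by move=> _ [A oA <-]; rewrite setTI; apply: open_measurableM; exact: cf.
Qed.

Lemma continuous_measurable_funMR p q (f : 'M[R]_(p, q) -> R) :
  continuous f -> measurable_fun (setT : set (borelM R p q)) f.
Proof.
move=> /continuousP cf.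
apply: (@measurability _ _ (borelM R p q) _ setT f (@measurable_realfun.RGenOpens.G R)).
  exact: measurable_realfun.RGenOpens.measurableE.
move=> _ [_ [a [b ->]] <-]; rewrite setTI; apply: open_measurableM.
exact/cf/interval_open.
Qed.

Lemma ballM_rational p q (x : 'M[R]_(p, q)) (e : R) : 0 < e ->
  exists (c : 'M[rat]_(p, q)) (k : nat),
    ball (map_mx ratr c : 'M[R]_(p, q)) k.+1%:R^-1 x /\
    ball (map_mx ratr c : 'M[R]_(p, q)) k.+1%:R^-1 `<=` ball x e.
Proof.
move=> e0.
(* With radius below [e / 2], any ball of that radius containing [x] stays inside [ball x e], by the
   triangle inequality through its centre. *)
have [k ke] : exists k, 0 + k.+1%:R^-1 < e / 2 by apply: ltr_add_invr; rewrite divr_gt0.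
rewrite add0r in ke.
have k0 : 0 < k.+1%:R^-1 :> R by rewrite invr_gt0 ltr0n.
have ex i j : exists r : rat, `|ratr r - x i j| < k.+1%:R^-1.
  have : x i j - k.+1%:R^-1 < x i j + k.+1%:R^-1.
    by rewrite ltrBlDr -addrA ltrDl addr_gt0.
  move=> /rat_in_itvoo[r]; rewrite in_itv/= => /andP[r1 r2].
  by exists r; rewrite ltr_distl r1 r2.
pose c : 'M[rat]_(p, q) := \matrix_(i, j) sval (cid (ex i j)).
have cx : ball (map_mx ratr c : 'M[R]_(p, q)) k.+1%:R^-1 x.
  by split => // i j; rewrite !mxE; case: cid.
exists c, k; split=> // y cy.
apply: (@ball_split _ _ (map_mx ratr c : 'M[R]_(p, q))); apply: le_ball (ltW ke) _ _ => //.
exact: ball_sym.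
Qed.

(** Lindelöf property for a hereditary [P]: enumerate the balls with rational centre and radius
    [k.+1%:R^-1] that satisfy [P], with [set0] at all other indices. Every point of an open set
    satisfying [P] lies in such a ball contained in that set. *)
Lemma lindelofM p q (P : set (set 'M[R]_(p, q))) : P set0 ->
  (forall A B, A `<=` B -> P B -> P A) ->
  exists F : nat -> set 'M[R]_(p, q), (forall n, open (F n) /\ P (F n)) /\
    (forall O, open O -> P O -> O `<=` \bigcup_n F n).
Proof.
move=> P0 subP.
pose B (ck : 'M[rat]_(p, q) * nat) : set 'M[R]_(p, q) :=
  ball (map_mx ratr ck.1 : 'M[R]_(p, q)) ck.2.+1%:R^-1.
pose F n := if unpickle n is Some ck then
  if `[< P (B ck) >] then B ck else set0 else set0.
exists F; split=> [n|O oO PO x Ox].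
  rewrite /F; case: unpickle => [ck|]; last by split => //; exact: open0.
  by case: asboolP => PB; split => //; exact: ball_open.
have /nbhs_ballP[e /= e0 eO] := open_nbhs_nbhs (conj oO Ox).
have [c [k [cx ce]]] := ballM_rational x e0.
exists (pickle (c, k)) => //; rewrite /F pickleK.
by case: asboolP => // -[]; apply: subP PO; exact: subset_trans ce eO.
Qed.

(** Lindelöf applied to the open sets whose trace on [M] fits in the image of a single chart.
    Guarding the property by nonemptiness of the trace makes it immediate for [set0]. *)
Lemma smooth_part_cover p q (M : set 'M[R]_(p, q)) :
  exists F : nat -> set 'M[R]_(p, q),
    [/\ forall n, open (F n),
        forall n, M `&` F n !=set0 -> exists m (U : set 'rV[R]_m) f,
          local_param M U f /\ M `&` F n `<=` f @` U &
        smooth_part M `<=` \bigcup_n F n].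
Proof.
pose P (O : set 'M[R]_(p, q)) := M `&` O !=set0 ->
  exists m (U : set 'rV[R]_m) f, local_param M U f /\ M `&` O `<=` f @` U.
have [||F [oF coverF]] := @lindelofM p q P.
- by move=> [x []].
- move=> A B AB PB [x [Mx Ax]].
  have [|m [U [f [lpf fU]]]] := PB; first by exists x; split => //; exact: AB.
  by exists m, U, f; split => //; apply: subset_trans fU; exact: setIS.
exists F; split=> [n|n|x [m [U [f [lpf fUx]]]]].
- by have [] := oF n.
- by have [] := oF n.
have [oU _ _ _ /(_ U oU (@subset_refl _ _))[W oW fW]] := lpf.
apply: (coverF W oW).
  by move=> _; exists m, U, f; split => //; rewrite fW.
by move: fUx; rewrite fW => -[].
Qed.

Lemma smooth_part_sub p q (M : set 'M[R]_(p, q)) : smooth_part M `<=` M.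
Proof.
move=> x [m [U [f [[oU _ _ _ /(_ U oU (@subset_refl _ _))[W oW fW]]]]]].
by rewrite fW => -[].
Qed.

End borel_matrix.

(** * Invariance of the Riemannian volume under linear isometries *)

Section isometry_volume.
Variables (R : realType) (p q : nat) (M : set 'M[R]_(p, q)).
Variables T S : {linear 'M[R]_(p, q) -> 'M[R]_(p, q)}.
Hypotheses (cT : continuous T) (cS : continuous S).
Hypotheses (TK : cancel T S) (SK : cancel S T).
Hypothesis dotT : forall A B, dotM (T A) (T B) = dotM A B.
Hypothesis MT : forall A, M (T A) <-> M A.
Hypothesis mM : measurable (M : set (borelM R p q)).

Lemma measurable_preimage_continuousM (f : 'M[R]_(p, q) -> 'M[R]_(p, q))
    (B : set (borelM R p q)) :
  continuous f -> measurable B -> measurable (f @^-1` B : set (borelM R p q)).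
Proof.
move=> cf mB; rewrite -[X in measurable X]setTI.
exact: continuous_measurable_funM.
Qed.

Lemma dotS A B : dotM (S A) (S B) = dotM A B.
Proof. by rewrite -dotT !SK. Qed.

Lemma MS A : M (S A) <-> M A.
Proof. by rewrite -{2}(SK A); exact: iff_sym. Qed.

(** The two integrands agree pointwise: [S \o f] pulls [T @^-1] B[back to]f @^-1[B], and the Gram
    matrices coincide on [U], outside of which both indicators vanish. *)
Lemma param_volume_isometry m (U : set 'rV[R]_m) f (B : set 'M[R]_(p, q)) :
  local_param M U f -> param_volume U (S \o f) (T @^-1` B) = param_volume U f B.
Proof.
move=> [oU sf _ _ _]; rewrite /param_volume; congr lebesgue_integral_rV.
apply/funext => u; have [Uu|nUu] := pselect (U u); last first.
  by rewrite !indicE !memNset ?mul0r// => -[].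
rewrite gram_isometry_comp//; [|exact: dotS|by case: (sf 1%N) => + _; exact].
congr (((\1_(U `&` _) _ : R) * _)%:E).
by apply/seteqP; split=> v /=; rewrite SK.
Qed.

(** Cut [B] along disjoint pieces, each inside one chart [f]. The preimage of a piece lies in the
    chart [S \o f], so [muE] computes both measures, and they agree term by term. *)
Lemma riemannian_volume_isometry (mu : {measure set (borelM R p q) -> \bar R})
    (B : set (borelM R p q)) :
  riemannian_volume M mu -> measurable B -> mu (T @^-1` B) = mu B.
Proof.
move=> [mu0 muE] mB.
have mT (A : set (borelM R p q)) :
    measurable A -> measurable (T @^-1` A : set (borelM R p q)).
  exact: measurable_preimage_continuousM.
have [F [oF chartF coverF]] := smooth_part_cover M.
pose G n : set (borelM R p q) := M `&` F n.
have mG n : measurable (G n) by apply: measurableI => //; exact: open_measurableM.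
have coverG : smooth_part M `<=` \bigcup_n G n.
  move=> x sx; have [n _ Fx] := coverF x sx.
  by exists n => //; split => //; exact: smooth_part_sub.
have mD n : measurable (seqDU G n) by exact: seqDU_measurable.
have mUD : measurable (\bigcup_n seqDU G n) by exact: bigcupT_measurable.
have D0 : mu (~` \bigcup_n seqDU G n) = 0%E.
  apply: measure_negligible; first exact: measurableC.
  by apply: negligibleS mu0; rewrite -seqDU_bigcup_eq; exact: subsetC.
rewrite [RHS](measure_sum_partition mD (@trivIset_seqDU _ G) D0 mB).
pose D' n : set (borelM R p q) := T @^-1` seqDU G n.
have tD' : trivIset setT D'.
  apply/trivIsetP => i j _ _ ij; rewrite -preimage_setI.
  by have /trivIsetP -> := @trivIset_seqDU _ G; rewrite ?preimage_set0.
(* [T] preserves the smooth part, so a point missed by every [D' n] is not smooth. *)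
have D'0 : mu (~` \bigcup_n D' n) = 0%E.
  rewrite -preimage_bigcup preimage_setC; apply: measure_negligible.
    by apply: mT; exact: measurableC.
  apply: negligibleS mu0; rewrite -seqDU_bigcup_eq => x /= nx sx.
  apply/nx/coverG.
  exact: (smooth_part_isometry cT cS TK SK dotT MT).
rewrite (measure_sum_partition _ tD' D'0 (mT _ mB)); last by move=> n; exact: mT.
apply: eq_eseriesr => n _; rewrite -preimage_setI.
set C := B `&` seqDU G n.
have mC : measurable C by exact: measurableI.
have CG : C `<=` G n by move=> x [_ Dx]; exact: subset_seqDU Dx.
(* The cover supplies a chart only for nonempty [G n]; otherwise the piece is empty and both sides
   are zero. *)
have [G0|/set0P G0] := eqVneq (G n) set0.
  by move: CG; rewrite G0 subset0 => ->; rewrite preimage_set0.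
have [m [U [f [lpf fU]]]] := chartF n G0.
have CU : C `<=` f @` U by exact: subset_trans fU.
rewrite [RHS](muE _ _ _ lpf)// -(param_volume_isometry _ lpf); apply: muE.
- exact: (local_param_isometry_comp cS cT SK TK dotS MS).
- exact: mT.
- by move=> x /CU[u Uu fu]; exists u => //=; rewrite fu TK.
Qed.

Lemma normalized_volume_isometry (P : probability (borelM R p q) R)
    (B : set (borelM R p q)) :
  normalized_volume M P -> measurable B -> P (T @^-1` B) = P B.
Proof.
move=> [mu [mu_vol _ PE]] mB; rewrite !PE ?riemannian_volume_isometry//.
exact: measurable_preimage_continuousM.
Qed.

End isometry_volume.

Lemma normalized_volume_support (R : realType) p q (M : set 'M[R]_(p, q))
    (P : probability (borelM R p q) R) :
  measurable (M : set (borelM R p q)) -> normalized_volume M P ->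
  P (~` M) = 0%E.
Proof.
move=> mM [mu [[mu0 _] _ PE]]; rewrite PE; last exact: measurableC.
rewrite (_ : mu (~` M) = 0%E) ?mule0//.
apply: measure_negligible; first exact: measurableC.
by apply: negligibleS mu0; apply: subsetC; exact: smooth_part_sub.
Qed.

(** * The Euclidean inner product of matrices *)

Section dotM_theory.
Context {R : realType} {p q : nat}.
Implicit Types A B C : 'M[R]_(p, q).

Lemma dotMC A B : dotM A B = dotM B A.
Proof. by apply: eq_bigr => i _; apply: eq_bigr => j _; rewrite mulrC. Qed.

Lemma dotMDl A B C : dotM (A + B) C = dotM A C + dotM B C.
Proof.
rewrite -big_split; apply: eq_bigr => i _; rewrite -big_split.
by apply: eq_bigr => j _; rewrite mxE mulrDl.
Qed.

Lemma dotMNl A B : dotM (- A) B = - dotM A B.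
Proof.
rewrite -sumrN; apply: eq_bigr => i _; rewrite -sumrN.
by apply: eq_bigr => j _; rewrite mxE mulNr.
Qed.

Lemma dotM0l A : dotM 0 A = 0.
Proof. by apply: big1 => i _; apply: big1 => j _; rewrite mxE mul0r. Qed.

Lemma dotMDr A B C : dotM A (B + C) = dotM A B + dotM A C.
Proof. by rewrite dotMC dotMDl !(dotMC A). Qed.

Lemma dotMNr A B : dotM A (- B) = - dotM A B.
Proof. by rewrite dotMC dotMNl dotMC. Qed.

Lemma dotM_suml I (s : seq I) (P : pred I) (F : I -> 'M[R]_(p, q)) B :
  dotM (\sum_(i <- s | P i) F i) B = \sum_(i <- s | P i) dotM (F i) B.
Proof. exact: (big_morph _ (fun A C => dotMDl A C B) (dotM0l B)). Qed.

Lemma dotM_sumr I (s : seq I) (P : pred I) (F : I -> 'M[R]_(p, q)) B :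
  dotM B (\sum_(i <- s | P i) F i) = \sum_(i <- s | P i) dotM B (F i).
Proof. by rewrite dotMC dotM_suml; apply: eq_bigr => i _; exact: dotMC. Qed.

Lemma dotM_ge0 A : 0 <= dotM A A.
Proof. by apply: sumr_ge0 => i _; apply: sumr_ge0 => j _; rewrite -expr2 sqr_ge0. Qed.

Lemma enorm_sqr A : enorm A ^+ 2 = dotM A A.
Proof. by rewrite sqr_sqrtr// dotM_ge0. Qed.

(** Cauchy-Schwarz for vectors of equal length, where expanding the squared norms of [A + B] and
    [A - B] is enough. *)
Lemma dotM_le_enorm A B r : enorm A = r -> enorm B = r -> `|dotM A B| <= r ^+ 2.
Proof.
move=> Ar Br; rewrite ler_norml.
have := dotM_ge0 (A + B); have := dotM_ge0 (A - B).
rewrite !(dotMDl, dotMDr, dotMNl, dotMNr) (dotMC B A) -!enorm_sqr Ar Br.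
by move=> h1 h2; apply/andP; split; lra.
Qed.

End dotM_theory.

Lemma dotM_row_perm (R : realType) (n d : nat) (s : {perm 'I_n}) (A B : 'M[R]_(n, d)) :
  dotM (row_perm s A) (row_perm s B) = dotM A B.
Proof.
rewrite /dotM [RHS](reindex_inj (@perm_inj _ s)) /=.
by apply: eq_bigr => i _; apply: eq_bigr => j _; rewrite !mxE.
Qed.

Lemma continuous_mxP (R : realType) (T : topologicalType) p q (f : T -> 'M[R]_(p, q)) :
  (forall i j, continuous (fun x => f x i j)) -> continuous f.
Proof.
move=> cf x; apply/cvg_ballP => e e0.
have : \forall y \near x, forall ij : 'I_p * 'I_q,
    ball (f x ij.1 ij.2) e (f y ij.1 ij.2).
  apply: filter_forall => -[i j] /=.
  by have /cvg_ballP := cf i j x; apply.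
by apply: filterS => y xy; split => // i j; exact: (xy (i, j)).
Qed.

(** * Measurability of rows, inner products, spheres, arms and polygons *)

Section measurability.
Variables (R : realType) (n d : nat).

Lemma measurable_coord (i : 'I_n) (b : 'I_d) :
  measurable_fun (setT : set (borelM R n d)) (fun e : borelM R n d => (e : 'M[R]_(n, d)) i b).
Proof. apply: continuous_measurable_funMR; exact: coord_continuous. Qed.

Lemma measurable_row (i : 'I_n) :
  measurable_fun (setT : set (borelM R n d)) (row i : borelM R n d -> borelM R 1 d).
Proof.
apply: continuous_measurable_funM; apply: continuous_mxP => a b.
under eq_fun do rewrite mxE.
exact: coord_continuous.
Qed.

Lemma row_perm_continuous (s : {perm 'I_n}) :
  continuous (row_perm s : 'M[R]_(n, d) -> 'M[R]_(n, d)).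
Proof.
apply: continuous_mxP => a b; under eq_fun do rewrite mxE.
exact: coord_continuous.
Qed.

Lemma measurable_dotM d' (T : measurableType d') (f g : T -> borelM R n d) :
  measurable_fun setT f -> measurable_fun setT g ->
  measurable_fun setT (fun x => dotM (f x : 'M[R]_(n, d)) (g x)).
Proof.
move=> mf mg; apply: measurable_sum => i; apply: measurable_sum => j.
apply: measurable_funM.
- exact: (measurableT_comp (measurable_coord i j) mf).
- exact: (measurableT_comp (measurable_coord i j) mg).
Qed.

End measurability.

Lemma measurable_sphere (R : realType) (d : nat) (r : R) :
  measurable (sphere r : set (borelM R 1 d)).
Proof.
have me : measurable_fun (setT : set (borelM R 1 d)) (@enorm R 1 d).
  apply: (measurableT_comp (continuous_measurable_fun (@sqrt_continuous R))).
  exact: (@measurable_dotM R 1 d _ (borelM R 1 d) id id).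
rewrite [X in measurable X](_ : _ = setT `&` @enorm R 1 d @^-1` [set r]).
  exact: me.
by rewrite setTI.
Qed.

Lemma measurable_eArm (R : realType) (n d : nat) :
  measurable (@eArm R d n : set (borelM R n d)).
Proof.
rewrite [X in measurable X](_ : _ = \bigcap_(i in [set: 'I_n])
    (setT `&` row i @^-1` sphere (2 / n%:R))); last first.
  apply/seteqP; split=> e h i; last by have [_] := h i I.
  by move=> _; split => //; exact: h.
apply: fin_bigcap_measurable; first exact: finite_finset.
by move=> i _; apply: measurable_row => //; exact: measurable_sphere.
Qed.

Lemma measurable_ePol (R : realType) (n d : nat) :
  measurable (@ePol R d n : set (borelM R n d)).
Proof.
apply: measurableI; first exact: measurable_eArm.
pose X b (e : borelM R n d) := \sum_(i < n) (e : 'M[R]_(n, d)) i b.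
rewrite [X in measurable X](_ : _ = \bigcap_(b in [set: 'I_d])
    (setT `&` X b @^-1` [set 0])); last first.
  have XE b e : X b e = (\sum_(i < n) row i (e : 'M[R]_(n, d))) 0 b.
    by rewrite summxE; apply: eq_bigr => i _; rewrite mxE.
  apply/seteqP; split=> [e e0 b _|e h]; first by split; rewrite //= XE e0 mxE.
  by apply/rowP => b; have [_] := h b I; rewrite /= XE mxE.
apply: fin_bigcap_measurable; first exact: finite_finset.
move=> b _; apply: (@measurable_sum _ _ R setT) => //.
by move=> i; exact: measurable_coord.
Qed.

(** * Integrals on sets of full measure and under invariant maps *)

Section integral_facts.
Context d (T : measurableType d) (R : realType) (mu : {measure set T -> \bar R}).

Lemma ae_integral (A : set T) (f g : T -> \bar R) :
  measurable A -> mu (~` A) = 0%E ->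
  measurable_fun setT f -> measurable_fun setT g ->
  (forall x, A x -> f x = g x) ->
  (\int[mu]_x f x = \int[mu]_x g x)%E.
Proof.
move=> mA A0 mf mg fg; apply: ae_eq_integral => //.
exists (~` A); split => //; first exact: measurableC.
by move=> x /= h Ax; apply: h => _; rewrite fg.
Qed.

(** Meant for inner products of edges, which are bounded on the support of the measure but not on
    the whole matrix space. *)
Lemma ae_bounded_integrable (A : set T) (f : T -> R) (C : R) :
  (mu setT < +oo)%E -> measurable A -> mu (~` A) = 0%E ->
  measurable_fun setT f -> 0 <= C -> (forall x, A x -> `|f x| <= C) ->
  mu.-integrable setT (EFin \o f).
Proof.
move=> muT mA A0 mf C0 fC; apply/integrableP; split; first exact/measurable_EFinP.
apply: (@le_lt_trans _ _ (\int[mu]_x (cst C%:E) x)%E).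
  apply: ae_ge0_le_integral => //.
  - by apply: measurableT_comp => //; exact/measurable_EFinP.
  - exists (~` A); split => //; first exact: measurableC.
    by move=> x /= h Ax; apply: h => _; rewrite lee_fin fC.
by rewrite integral_cst// lte_mul_pinfty.
Qed.

Lemma integral_invariant (phi : T -> T) (f : T -> \bar R) :
  measurable_fun setT phi ->
  (forall B, measurable B -> mu (phi @^-1` B) = mu B) ->
  measurable_fun setT f -> mu.-integrable setT (f \o phi) ->
  (\int[mu]_x f (phi x) = \int[mu]_x f x)%E.
Proof.
move=> mphi inv mf intf.
rewrite -(integral_pushforward mphi mf intf measurableT).
by apply: eq_measure_integral => B mB _; exact: inv.
Qed.

End integral_facts.

Lemma perm_pair (T : finType) (i j i' j' : T) : i != j -> i' != j' ->
  exists s : {perm T}, s i = i' /\ s j = j'.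
Proof.
(* The first transposition sends [i] to [i'] and [j] to [j1], which differs from [i']; exchanging
   [j1] and [j'] then leaves [i'] fixed. *)
move=> ij i'j'; pose j1 := tperm i i' j.
exists (tperm i i' * tperm j1 j')%g; rewrite !permM tpermL tpermL; split => //.
rewrite tpermD// ?[j' == _]eq_sym//.
apply: contraNneq ij => j1i'.
by rewrite -(inj_eq (@perm_inj _ (tperm i i'))) tpermL eq_sym; apply/eqP.
Qed.

Definition dotrow {R : realType} {n d : nat} (i j : 'I_n) (e : 'M[R]_(n, d)) : R :=
  dotM (row i e) (row j e).

(** * The expected chord in terms of the mean inner products of edges *)

Section Chord.
Variables (R : realType) (n d : nat).

Lemma Chord_dotrow k (e : 'M[R]_(n, d)) :
  Chord k e = \sum_(i < n | (i < k)%N) \sum_(j < n | (j < k)%N) dotrow i j e.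
Proof.
rewrite /Chord enorm_sqr dotM_suml; apply: eq_bigr => i _; exact: dotM_sumr.
Qed.

Lemma measurable_dotrow i j :
  measurable_fun (setT : set (borelM R n d)) (dotrow i j : borelM R n d -> R).
Proof. by apply: measurable_dotM; exact: measurable_row. Qed.

Variable P : probability (borelM R n d) R.
Hypothesis P_eArm : P (~` @eArm R d n) = 0%E.

Lemma integrable_dotrow i j :
  P.-integrable setT (EFin \o (dotrow i j : borelM R n d -> R)).
Proof.
apply: (@ae_bounded_integrable _ _ _ P (@eArm R d n) _ ((2 / n%:R) ^+ 2)) => //.
- by rewrite [X in (X < _)%E]probability_setT ltry.
- exact: measurable_eArm.
- exact: measurable_dotrow.
- by move=> e earm; apply: dotM_le_enorm; exact: earm.
Qed.

Lemma integral_dotrow_diag i :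
  (\int[P]_e (dotrow i i (e : 'M[R]_(n, d)))%:E = ((2 / n%:R) ^+ 2)%:E)%E.
Proof.
rewrite (@ae_integral _ _ _ P (@eArm R d n) _ (cst ((2 / n%:R) ^+ 2)%:E))//.
- by rewrite integral_cst// [X in (_ * X)%E]probability_setT mule1.
- exact: measurable_eArm.
- by apply/measurable_EFinP; exact: measurable_dotrow.
- by move=> e earm; rewrite /dotrow -enorm_sqr earm.
Qed.

(** Among the [k] × [k] inner products, the [k] diagonal ones have mean [(2 / n%:R) ^+ 2] and all
    others have mean [c]. Arm and polygon differ only in the value of [c]. *)
Lemma expectation_Chord (c : R) (k : nat) : (k <= n)%N ->
  (forall i j : 'I_n, i != j ->
    (\int[P]_e (dotrow i j (e : 'M[R]_(n, d)))%:E = c%:E)%E) ->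
  ('E_P[@Chord R d n k])%E =
    (k%:R * (k%:R * c + (2 / n%:R) ^+ 2 - c))%:E.
Proof.
move=> kn Pc; rewrite unlock.
under eq_integral do rewrite Chord_dotrow -sumEFin.
rewrite integral_sum//; last first.
  move=> i; under eq_fun do rewrite -sumEFin.
  by apply: integrable_sum => // j _; exact: integrable_dotrow.
(* Each mean is written as [c] plus a correction on the diagonal, so that only sums of constants
   remain. *)
transitivity (\sum_(i < n | (i < k)%N) \sum_(j < n | (j < k)%N)
    (c + (if i == j then (2 / n%:R) ^+ 2 - c else 0))%:E)%E.
  apply: eq_bigr => i _; under eq_integral do rewrite -sumEFin.
  rewrite integral_sum//; last by move=> j; exact: integrable_dotrow.
  apply: eq_bigr => j _; case: eqVneq => [<-|ij].
    by rewrite integral_dotrow_diag addrC subrK.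
  by rewrite Pc// addr0.
under eq_bigr do rewrite sumEFin.
rewrite sumEFin; congr (_%:E).
have sumk (x : R) : \sum_(i < n | (i < k)%N) x = k%:R * x.
  by rewrite -(big_ord_widen n (fun=> x) kn) sumr_const card_ord mulr_natl.
rewrite -sumk; apply: eq_bigr => i ik; rewrite big_split /= sumk -addrA; congr (_ + _).
by rewrite (bigD1 i)//= eqxx big1 ?addr0// => j /andP[_ /negbTE]; rewrite eq_sym => ->.
Qed.

End Chord.

Lemma eArm_row_perm (R : realType) (d n : nat) (s : {perm 'I_n}) (e : 'M[R]_(n, d)) :
  eArm (row_perm s e) <-> eArm e.
Proof.
have rowE i : row i (row_perm s e) = row (s i) e by apply/rowP => b; rewrite !mxE.
split=> earm i; last by rewrite rowE.
by rewrite -(permKV s i) -rowE.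
Qed.

Lemma ePol_row_perm (R : realType) (d n : nat) (s : {perm 'I_n}) (e : 'M[R]_(n, d)) :
  ePol (row_perm s e) <-> ePol e.
Proof.
suff sumE : \sum_i row i (row_perm s e) = \sum_i row i e.
  by split=> -[/eArm_row_perm ? /=]; rewrite ?sumE => ?; split => //=; rewrite ?sumE.
rewrite [RHS](reindex_inj (@perm_inj _ s)) /=; apply: eq_bigr => i _.
by apply/rowP => b; rewrite !mxE.
Qed.

(** * Closed polygons: exchangeability of the edges *)

Section ePol.
Variables (R : realType) (n d : nat) (P : probability (borelM R n d) R).
Hypothesis PP : ePol_measure P.

Lemma ePol_supported : P (~` @ePol R d n) = 0%E.
Proof. by apply: normalized_volume_support => //; exact: measurable_ePol. Qed.

Lemma ePol_eArm_supported : P (~` @eArm R d n) = 0%E.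
Proof.
apply: subset_measure0 ePol_supported.
- by apply: measurableC; exact: measurable_eArm.
- by apply: measurableC; exact: measurable_ePol.
- by apply: subsetC => e [].
Qed.

Lemma integral_dotrow_ePol (i j i' j' : 'I_n) : i != j -> i' != j' ->
  (\int[P]_e (dotrow i j (e : 'M[R]_(n, d)))%:E =
   \int[P]_e (dotrow i' j' (e : 'M[R]_(n, d)))%:E)%E.
Proof.
move=> ij i'j'; have [s [si sj]] := perm_pair ij i'j'.
have rowE l (e : 'M[R]_(n, d)) : row l (row_perm s e) = row (s l) e.
  by apply/rowP => b; rewrite !mxE.
have sE : (EFin \o (dotrow i j : borelM R n d -> R)) \o
      (row_perm s : borelM R n d -> borelM R n d)
    = EFin \o (dotrow i' j' : borelM R n d -> R).
  by apply/funext => e /=; rewrite /dotrow !rowE si sj.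
rewrite -(@integral_invariant _ _ _ P
  (row_perm s : borelM R n d -> borelM R n d)
  (EFin \o (dotrow i j : borelM R n d -> R))).
- by rewrite -[LHS]/(\int[P]_x ((EFin \o _) \o _) x)%E sE.
- by apply: continuous_measurable_funM; exact: row_perm_continuous.
(* Permuting rows is a linear isometry preserving [ePol], with inverse the row permutation by
   [s^-1]. *)
- move=> B mB.
  apply: (@normalized_volume_isometry _ _ _ (@ePol R d n) (row_perm s) (row_perm s^-1)) => //.
  + exact: row_perm_continuous.
  + exact: row_perm_continuous.
  + by move=> e; apply/matrixP => a b; rewrite !mxE permKV.
  + by move=> e; apply/matrixP => a b; rewrite !mxE permK.
  + exact: dotM_row_perm.
  + exact: ePol_row_perm.
  + exact: measurable_ePol.
- by apply/measurable_EFinP; exact: measurable_dotrow.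
- by rewrite sE; apply: integrable_dotrow; exact: ePol_eArm_supported.
Qed.

Lemma expectation_Chord_ePol_full : ('E_P[@Chord R d n n])%E = 0%E.
Proof.
rewrite unlock -[RHS](integral0 P setT).
rewrite [LHS](@ae_integral _ _ _ P (@ePol R d n) _ (cst 0%E)).
- by [].
- exact: measurable_ePol.
- exact: ePol_supported.
- apply/measurable_EFinP.
  have -> : @Chord R d n n = fun e => \sum_(i < n | (i < n)%N)
      \sum_(j < n | (j < n)%N) dotrow i j e by apply/funext => e; exact: Chord_dotrow.
  (* The bounds hold for every index when [k] is [n]; removing them gives the unfiltered sums to
     which [measurable_sum] applies. *)
  under eq_fun do (under eq_bigl do rewrite ltn_ord;
    under eq_bigr do under eq_bigl do rewrite ltn_ord).
  by apply: measurable_sum => i; apply: measurable_sum => j; exact: measurable_dotrow.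
- exact: measurable_cst.
- move=> e [_ /= e0]; congr (_%:E); rewrite /Chord enorm_sqr.
  rewrite (eq_bigl xpredT); last by move=> i; rewrite ltn_ord.
  by rewrite e0 dotM0l.
Qed.

End ePol.

(** * Arms: independence and symmetry of the edges *)

Section eArm.
Variables (R : realType) (n d : nat) (P : probability (borelM R n d) R).
Variable sigma : probability (borelM R 1 d) R.
Hypothesis sigma_vol : normalized_volume (@sphere R d (2 / n%:R)) sigma.
Hypothesis sigmaP : product_of_rows sigma P.

Let r : R := 2 / n%:R.

Lemma sphere_supported : sigma (~` sphere r) = 0%E.
Proof. by apply: normalized_volume_support => //; exact: measurable_sphere. Qed.

Lemma eArm_supported : P (~` @eArm R d n) = 0%E.
Proof.
have sigma1 : sigma (sphere r) = 1%E.
  rewrite -[sphere r]setCK probability_setC ?sphere_supported ?sube0//.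
  by apply: measurableC; exact: measurable_sphere.
rewrite probability_setC; last exact: measurable_eArm.
have -> : P (@eArm R d n) = 1%E.
  have := @sigmaP (fun=> sphere r) (fun=> @measurable_sphere R d r).
  by rewrite big1// => i _; exact: sigma1.
by rewrite subee.
Qed.

Lemma product_of_rows_pair (i j : 'I_n) (A B : set (borelM R 1 d)) : i != j ->
  measurable A -> measurable B ->
  P [set e : 'M[R]_(n, d) | A (row i e) /\ B (row j e)] = (sigma A * sigma B)%E.
Proof.
move=> ij mA mB.
(* Leaving the other rows unconstrained turns the event into a full product, whose remaining factors
   are all 1. *)
pose C l : set (borelM R 1 d) := if l == i then A else if l == j then B else setT.
have mC l : measurable (C l) by rewrite /C; do 2 case: ifP => // _.
have CE : [set e : 'M[R]_(n, d) | A (row i e) /\ B (row j e)]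
    = [set e | forall l, C l (row l e)].
  apply/seteqP; split=> e /=.
    by move=> [Ai Bj] l; rewrite /C; case: eqVneq => [->//|_]; case: eqVneq => [->|].
  move=> h; split; first by have := h i; rewrite /C eqxx.
  by have := h j; rewrite /C eq_sym (negbTE ij) eqxx.
rewrite CE sigmaP// (bigD1 i)//= (bigD1 j) 1?eq_sym//= big1 => [|l /andP[li lj]].
  by rewrite mule1 /C eqxx eq_sym (negbTE ij) eqxx.
by rewrite /C (negbTE li) (negbTE lj) probability_setT.
Qed.

Lemma measurable_row_pair (i j : 'I_n) :
  measurable_fun (setT : set (borelM R n d))
    (fun e : borelM R n d => (row i e : borelM R 1 d, row j e : borelM R 1 d)).
Proof. by apply: measurable_fun_pair; exact: measurable_row. Qed.

(** The antipodal map preserves [sigma] and changes the sign of the integrand, so the integral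
    equals its opposite. *)
Lemma integral_sphere_dotM (x : 'rV[R]_d) : enorm x = r ->
  (\int[sigma]_y (dotM x (y : 'rV[R]_d))%:E = 0)%E.
Proof.
move=> xr.
have mx : measurable_fun (setT : set (borelM R 1 d)) (fun y : borelM R 1 d => dotM x y).
  by apply: (@measurable_dotM R 1 d _ (borelM R 1 d) (cst x) id) => //; exact: measurable_cst.
have ix : sigma.-integrable setT (EFin \o (fun y : borelM R 1 d => dotM x y)).
  apply: (@ae_bounded_integrable _ _ _ sigma (sphere r) _ (r ^+ 2)) => //.
  - by rewrite [X in (X < _)%E]probability_setT ltry.
  - exact: measurable_sphere.
  - exact: sphere_supported.
  - exact: sqr_ge0.
  - by move=> y yr; exact: dotM_le_enorm.
have xN : ((EFin \o (fun y : borelM R 1 d => dotM x y)) \o (-%R : 'rV[R]_d -> 'rV[R]_d)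
    = \- (EFin \o (fun y : borelM R 1 d => dotM x y)))%E.
  by apply/funext => y /=; rewrite dotMNr.
have iE : (\int[sigma]_y (dotM x (y : 'rV[R]_d))%:E =
    - \int[sigma]_y (dotM x (y : 'rV[R]_d))%:E)%E.
  rewrite -[RHS]integralN; last first.
    by apply: integrable_add_def ix.
  rewrite -(@integral_invariant _ _ _ sigma (-%R : borelM R 1 d -> borelM R 1 d)
    (EFin \o (fun y : borelM R 1 d => dotM x y))).
  - by apply: eq_integral => y _ /=; rewrite dotMNr.
  - by apply: continuous_measurable_funM; exact: oppr_continuous.
  - move=> B mB.
    apply: (@normalized_volume_isometry _ _ _ (@sphere R d r) -%R -%R) => //.
    + exact: oppr_continuous.
    + exact: oppr_continuous.
    + exact: opprK.
    + exact: opprK.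
    + by move=> y z; rewrite dotMNl dotMNr opprK.
    + by move=> y; rewrite /sphere /= /enorm dotMNl dotMNr opprK.
    + exact: measurable_sphere.
  - exact/measurable_EFinP.
  - by rewrite xN; exact: integrableN.
(* Integrability makes the value a real [z], and [z = - z] then forces [z = 0]. *)
move: iE; have := integrable_fin_num measurableT ix.
rewrite -[X in X \is a _]/(\int[sigma]_y (dotM x (y : 'rV[R]_d))%:E)%E.
case: (\int[sigma]_y _)%E => // z _ [zN]; congr (_%:E); lra.
Qed.

(** Two distinct rows have joint law [sigma \x sigma]; by Fubini the inner integral runs over one
    sphere with the other edge fixed, and it vanishes by antipodal symmetry. *)
Lemma integral_dotrow_eArm (i j : 'I_n) : i != j ->
  (\int[P]_e (dotrow i j (e : 'M[R]_(n, d)))%:E = 0)%E.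
Proof.
move=> ij.
pose X : {mfun borelM R n d >-> (borelM R 1 d * borelM R 1 d)%type} :=
  mfun_Sub (mem_set (measurable_row_pair i j)).
pose f (z : borelM R 1 d * borelM R 1 d) := dotM (z.1 : 'rV[R]_d) z.2.
have mf : measurable_fun setT f.
  by apply: measurable_dotM; [exact: measurable_fst|exact: measurable_snd].
(* A product measure is determined by its values on measurable rectangles. *)
have PX A : measurable A -> distribution P X A = (sigma \x sigma)%E A.
  move=> mA; apply/esym; apply: product_measure_unique => // B C mB mC.
  exact: product_of_rows_pair.
have mS := @measurable_sphere R d r.
have intf : (sigma \x sigma)%E.-integrable setT (EFin \o f).
  apply: (@ae_bounded_integrable _ _ _ (sigma \x sigma)%E
    (sphere r `*` sphere r) _ (r ^+ 2)) => //.
  - rewrite -[X in (X < _)%E](PX setT)//; apply: le_lt_trans (ltry 1); exact: probability_le1.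
  - exact: measurableX.
  (* Read through the law of [X], this set pulls back to matrices with a row off the sphere, all
     outside [eArm]. *)
  - rewrite -[LHS](PX (~` (sphere r `*` sphere r))); last first.
      by apply: measurableC; exact: measurableX.
    apply: subset_measure0 eArm_supported.
    + rewrite -[X in measurable X]setTI; apply: measurable_row_pair => //.
      by apply: measurableC; exact: measurableX.
    + by apply: measurableC; exact: measurable_eArm.
    + by move=> e /= ne earm; apply: ne; split; exact: earm.
  - exact: sqr_ge0.
  - by move=> z [z1 z2]; exact: dotM_le_enorm.
transitivity (\int[distribution P X]_z (f z)%:E)%E.
  rewrite integral_distribution//; first exact/measurable_EFinP.
  by apply: integrable_dotrow; exact: eArm_supported.
rewrite (@eq_measure_integral _ _ _ _ (sigma \x sigma)%E) => [|A mA _]; last exact: PX.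
rewrite -(integral12_prod_meas1 intf) -[RHS](integral0 sigma setT).
apply: (@ae_integral _ _ _ sigma (sphere r) _ (cst 0%E)) => //.
- exact: sphere_supported.
- exact: measurable_fubini_F intf.
- by move=> x xr; exact: integral_sphere_dotM.
Qed.

End eArm.

(** * The two expectations *)

Lemma expectation_Chord_eArm (R : realType) (n d k : nat)
    (P : probability (borelM R n d) R) :
  (k <= n)%N -> eArm_measure P ->
  ('E_P[@Chord R d n k])%E = (k%:R * (2 / n%:R) ^+ 2)%:E.
Proof.
move=> kn [sigma sigma_vol sigmaP].
rewrite (@expectation_Chord _ _ _ _ (eArm_supported sigma_vol sigmaP) 0)//.
  by rewrite mulr0 add0r subr0.
by move=> i j ij; exact: integral_dotrow_eArm sigma_vol sigmaP _ _ ij.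
Qed.

Lemma expectation_Chord_ePol (R : realType) (n d k : nat)
    (P : probability (borelM R n d) R) :
  (1 < n)%N -> (k <= n)%N -> ePol_measure P ->
  ('E_P[@Chord R d n k])%E =
    (k%:R * (n - k)%:R / (n - 1)%:R * (2 / n%:R) ^+ 2)%:E.
Proof.
move=> n1 kn PP.
have supp := ePol_eArm_supported PP.
(* As [n] exceeds 1 there are two distinct edges; their mean inner product [c] serves for every
   pair. *)
pose i0 : 'I_n := Ordinal (ltnW n1); pose i1 : 'I_n := Ordinal n1.
pose I := (\int[P]_e (dotrow i0 i1 (e : 'M[R]_(n, d)))%:E)%E.
pose c := fine I.
have Ic : I = c%:E.
  apply/esym/fineK; apply: (@integrable_fin_num _ _ _ P setT measurableT).
  exact: integrable_dotrow.
have Pc (i j : 'I_n) : i != j ->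
    (\int[P]_e (dotrow i j (e : 'M[R]_(n, d)))%:E)%E = c%:E.
  by move=> ij; rewrite -Ic; exact: integral_dotrow_ePol.
(* Evaluating the general formula at [k = n], where the chord vanishes, and cancelling [n] leaves a
   linear equation relating [c] to the squared edge length. *)
have := expectation_Chord_ePol_full PP.
rewrite (expectation_Chord supp (leqnn n) Pc) => -[]/eqP.
have n0 : n%:R != 0 :> R by rewrite pnatr_eq0 -lt0n ltnW.
rewrite mulf_eq0 (negbTE n0) /= => /eqP cE.
rewrite (expectation_Chord supp kn Pc); congr (_%:E).
have n10 : n%:R - 1 != 0 :> R by rewrite subr_eq0 pnatr_eq1 gtn_eqF.
rewrite !natrB ?(ltnW n1)//; set r2 := (2 / n%:R) ^+ 2 in cE *.
(* Eliminating [r2] rather than [c] keeps the substitution free of division; the quotient by [n - 1]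
   in the goal then cancels since [n10] holds. *)
have -> : r2 = - (n%:R - 1) * c by lra.
by field.
Qed.

Unset Implicit Arguments.

Theorem proposition21 (R : realType) (d n k : nat)
    (hd : d = 2%N \/ d = 3%N) (hk : (k <= n)%N) :
  ((0 < n)%N ->
     forall P : probability (borelM R n d) R, eArm_measure P ->
       ('E_P[@Chord R d n k])%E = (4 * k%:R / n%:R ^+ 2)%:E) /\
  ((1 < n)%N ->
     forall P : probability (borelM R n d) R, ePol_measure P ->
       ('E_P[@Chord R d n k])%E
         = ((n - k)%:R / (n - 1)%:R * (4 * k%:R / n%:R ^+ 2))%:E).
Proof.
have r2E : (2 / n%:R) ^+ 2 = 4 / n%:R ^+ 2 :> R by rewrite expr_div_n -(natrX R 2 2).
split=> n1 P PP.
  by rewrite (expectation_Chord_eArm hk PP) r2E mulrCA mulrA.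
rewrite (expectation_Chord_ePol n1 hk PP) r2E; congr (_%:E).
ring.
Qed.
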